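(* Let $k\in\mathbb{N}$ and let $G=(V,E)$ be a unit-distance graph in the plane with a vertex $v_0\in V$ such that $G$ has no proper $k$-colouring with bichromatic origin $v_0$. Let $C(G,v_0)$ be the bouquet through $v_0$ consisting of the unit circles centred at the neighbours of $v_0$. Suppose that every colouring of $\mathbb{R}^2$ with finitely many but at least two colours contains a smiling congruent copy of $C(G,v_0)$. Then $\chi(\mathbb{R}^2)\ge k+1$.
   Context: A unit-distance graph in the plane is a graph with $V\subseteq\mathbb{R}^2$ such that $(v,w)\in E$ implies $\|v-w\|=1$. A proper $k$-colouring of $G$ with bichromatic origin $v_0$ is a map $\varphi$ assigning to each $v\in V\setminus\{v_0\}$ a one-element subset of $[k]$ and to $v_0$ a two-element subset of $[k]$, such that $(v,w)\in E$ implies $\varphi(v)\cap\varphi(w)=\emptyset$. A bouquet through $O$ is a union of unit circles all passing through $O$; a congruent copy is its image under a plane isometry $g$ (a bouquet through $g(O)$). For a colouring, a bouquet $C_1\cup\dots\cup C_n$ through $O$ is smiling if some colour $c$ appears on every $C_i$ but $O$ does not have colour $c$. $\chi(\mathbb{R}^2)$ is the least $k$ such that there is $\varphi:\mathbb{R}^2\to[k]$ with $\varphi(p)\neq\varphi(q)$ whenever $\|p-q\|=1$. *)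

(* Defs.v *)
From mathcomp Require Import all_boot all_order all_algebra.
From mathcomp Require Import boolp classical_sets reals.
From mathcomp Require Import zify lra.

Set Implicit Arguments.
Unset Strict Implicit.
Unset Printing Implicit Defensive.

Import Order.TTheory GRing.Theory Num.Theory.

Local Open Scope classical_set_scope.
Local Open Scope ring_scope.

Notation plane R := 'rV[R]_2.

(* The Euclidean distance is spelled out because the norm that
   MathComp-Analysis puts on row vectors is the sup norm. *)
Definition edist (R : realType) (p q : plane R) : R :=
  Num.sqrt (\sum_(i < 2) (p 0 i - q 0 i) ^+ 2).

Definition plane_isometry (R : realType) (g : plane R -> plane R) : Prop :=
  forall p q, edist (g p) (g q) = edist p q.

(* Neither finiteness of the vertex set nor local finiteness is required, and
   not every pair of vertices at distance 1 has to be an edge. *)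
Record unit_distance_graph (R : realType) := UnitDistanceGraph {
  vertices : set (plane R);
  edge : plane R -> plane R -> Prop;
  edge_vertices : forall v w, edge v w -> vertices v /\ vertices w;
  edge_sym : forall v w, edge v w -> edge w v;
  edge_unit : forall v w, edge v w -> edist v w = 1 }.

(* phi is a total function, but its values outside the vertex set are
   unconstrained. *)
Definition proper_bichromatic_colouring (R : realType)
    (G : unit_distance_graph R) (v0 : plane R) (k : nat)
    (phi : plane R -> {set 'I_k}) : Prop :=
  [/\ forall v, vertices G v -> v <> v0 -> #|phi v| = 1%N,
      #|phi v0| = 2%N &
      forall v w, edge G v w -> phi v :&: phi w = finset.set0].

Definition unit_circle (R : realType) (x : plane R) : set (plane R) :=
  [set p | edist p x = 1].

(* A bouquet is kept as its set of circles rather than as the union of these,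
   since smiling refers to the individual circles, which an infinite union does
   not determine. *)
Definition is_bouquet (R : realType) (O : plane R) (B : set (set (plane R))) :
    Prop :=
  forall C, B C -> C O /\ exists x, C = unit_circle x.

Definition congruent_copy (R : realType) (g : plane R -> plane R)
    (B : set (set (plane R))) : set (set (plane R)) :=
  [set g @` C | C in B].

Definition smiling (R : realType) (T : Type) (f : plane R -> T) (O : plane R)
    (B : set (set (plane R))) : Prop :=
  exists c : T, (forall C, B C -> exists2 p, C p & f p = c) /\ f O <> c.

Definition graph_bouquet (R : realType) (G : unit_distance_graph R)
    (v0 : plane R) : set (set (plane R)) :=
  [set unit_circle w | w in [set w | edge G v0 w]].

Lemma graph_bouquetP (R : realType) (G : unit_distance_graph R) (v0 : plane R) :
  is_bouquet v0 (graph_bouquet G v0).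
Proof. by move=> _ [w vw <-]; split; [exact: edge_unit vw | exists w]. Qed.

Definition plane_colourable (R : realType) (k : nat) : Prop :=
  exists f : plane R -> 'I_k, forall p q, edist p q = 1 -> f p <> f q.

(* Cut the plane into half-open squares of side 2/3, and colour each square by
   its two integer coordinates modulo 3. *)
Lemma ex_plane_colourable (R : realType) :
  exists k, `[< plane_colourable R k >].
Proof.
pose cell (p : plane R) i : int := Num.floor (p 0 i * (3 / 2)).
pose col (p : plane R) : {ffun 'I_2 -> 'I_3} :=
  [ffun i => inord `|(cell p i %% 3)%Z|].
exists #|{: {ffun 'I_2 -> 'I_3}}|; apply/asboolP.
exists (fun p => enum_rank (col p)) => p q pq1 /enum_rank_inj pq.
have D1 : \sum_(i < 2) (p 0 i - q 0 i) ^+ 2 = 1.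
  rewrite -[LHS]sqr_sqrtr; first by rewrite -/(edist p q) pq1 expr1n.
  by apply: sumr_ge0 => i _; exact: sqr_ge0.
have le1 i : (p 0 i - q 0 i) ^+ 2 <= 1.
  by rewrite -D1 (bigD1 i) //= lerDl sumr_ge0 // => j _; exact: sqr_ge0.
have lt49 i : (p 0 i - q 0 i) ^+ 2 < 4 / 9.
  have := congr1 (fun h : {ffun 'I_2 -> 'I_3} => val (h i)) pq.
  rewrite !ffunE /= !inordK; [|by lia|by lia].
  have /andP[pl pu] := real_floor_itv (num_real (p 0 i * (3 / 2))).
  have /andP[ql qu] := real_floor_itv (num_real (q 0 i * (3 / 2))).
  rewrite -!/(cell _ i) in pl pu ql qu.
  move: (le1 i) => le1i eqm; rewrite !intrD in pu qu.
  have b1 : cell p i - cell q i < 3.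
    rewrite -(ltr_int R) intrB; nra.
  have b2 : - 3 < cell p i - cell q i.
    rewrite -(ltr_int R) intrB; nra.
  have e : cell p i = cell q i by lia.
  rewrite e in pl pu; nra.
have := ltrD (lt49 0) (lt49 1).
move: D1; rewrite big_ord_recl big_ord1.
have -> : lift ord0 ord0 = 1 :> 'I_2 by exact: val_inj.
by move=> ->; lra.
Qed.

Definition plane_chromatic_number (R : realType) : nat :=
  ex_minn (ex_plane_colourable R).

(* Main.v *)
Require Import Defs.
From mathcomp Require Import all_boot all_order all_algebra.
From mathcomp Require Import boolp classical_sets reals.

(* In a proper k-colouring of the plane, a smiling copy of the bouquet has its
   centre at a point that can be given the smiling colour c as a second colour:
   the centre of each circle is at distance 1 from a point coloured c on that
   circle, so no neighbour of the origin is coloured c.  Pulling back along the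
   isometry gives a k-colouring of G with bichromatic origin. *)

Import Order.TTheory GRing.Theory Num.Theory.

Local Open Scope ring_scope.

Lemma edistxx (R : realType) (p : plane R) : edist p p = 0.
Proof. by rewrite /edist big1 ?sqrtr0 // => i _; rewrite subrr expr0n. Qed.

(** A pair of points at distance 1 shows that a proper colouring of the plane is not constant. *)
Lemma edist_delta (R : realType) : edist (0 : plane R) (delta_mx 0 0) = 1.
Proof.
rewrite /edist (bigD1 0) //= big1 => [|i /negbTE i0].
  by rewrite !mxE !eqxx sub0r sqrrN expr1n addr0 sqrtr1.
by rewrite !mxE i0 andbF subrr expr0n.
Qed.

Lemma bichromatic_of_smiling (R : realType) (k : nat)
    (G : unit_distance_graph R) (v0 : plane R) (f : plane R -> 'I_k)
    (g : plane R -> plane R) :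
  (forall p q, edist p q = 1 -> f p <> f q) ->
  plane_isometry g ->
  smiling f (g v0) (congruent_copy g (graph_bouquet G v0)) ->
  exists phi : plane R -> {set 'I_k}, proper_bichromatic_colouring G v0 phi.
Proof.
move=> f_proper g_iso [c [c_circles c_origin]].
have edge_neq v w : edge G v w -> f (g v) != f (g w).
  by move=> vw; apply/eqP/f_proper; rewrite g_iso (edge_unit vw).
have nbr_neq w : edge G v0 w -> c != f (g w).
  (* The point coloured [c] on the image circle has the form [g p] with [p] at distance 1 from
     [w]. *)
  move=> v0w; have [|_ [p pw <-] <-] := c_circles (g @` unit_circle w)%classic.
    by exists (unit_circle w) => //; exists w.
  by apply/eqP/f_proper; rewrite g_iso.
exists (fun v => if v == v0 then [set f (g v0); c] else [set f (g v)]).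
split=> [v _ /eqP/negbTE -> | | v w vw].
- exact: cards1.
- by rewrite eqxx cards2; move/eqP: c_origin => ->.
apply/eqP; rewrite setI_eq0.
case: (eqVneq v v0) vw => [-> | vNv0]; case: (eqVneq w v0) => [-> | wNv0] vw.
(* A loop at [v0] would have length 0 instead of 1. *)
- by have := edge_unit vw; rewrite edistxx => /esym/eqP; rewrite oner_eq0.
- by rewrite disjoint_sym disjoints1 !inE negb_or ![f (g w) == _]eq_sym edge_neq
    ?nbr_neq.
- rewrite disjoints1 !inE negb_or edge_neq //= eq_sym nbr_neq //.
  exact: edge_sym vw.
- by rewrite disjoints1 inE edge_neq.
Qed.

Theorem theorem5p1 (R : realType) (k : nat) (G : unit_distance_graph R)
    (v0 : plane R) :
  vertices G v0 ->
  ~ (exists phi : plane R -> {set 'I_k},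
       proper_bichromatic_colouring G v0 phi) ->
  (forall (m : nat) (f : plane R -> 'I_m),
     (exists p q, f p <> f q) ->
     exists g : plane R -> plane R,
       plane_isometry g /\
       smiling f (g v0) (congruent_copy g (graph_bouquet G v0))) ->
  (k + 1 <= plane_chromatic_number R)%N.
Proof.
move=> _ no_bichromatic smiles; rewrite addn1 /plane_chromatic_number.
case: ex_minnP => n /asboolP[h h_proper] _; case: ltnP => // le_nk.
case: no_bichromatic; pose f p := widen_ord le_nk (h p).
have f_proper p q : edist p q = 1 -> f p <> f q.
  by move=> /h_proper hpq /(congr1 val) /= /val_inj.
have [|g [g_iso g_smiling]] := smiles k f.
  by exists 0, (delta_mx 0 0); exact/f_proper/edist_delta.
exact: bichromatic_of_smiling g_smiling.
Qed.
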